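(* Let $n\ge m\ge 3$. Then $$\mu_{\rm d}(C_n\,\square\,C_m)=\begin{cases}5, & (n,m)\in\{(3,3),(4,3)\},\\ 8, & (n,m)=(4,4),\\ 2, & (n,m)=(5,3),\\ 4, & (n,m)\in\{(5,4),(6,3),(6,4)\},\\ 0, & \text{otherwise}.\end{cases}$$
   Context: $C_n$ is the cycle on $n$ vertices and $C_n\,\square\,C_m$ is the Cartesian product (torus graph). For a graph $G$ and $X\subseteq V(G)$, vertices $u,v\in V(G)$ are $X$-visible if there exists a shortest $u,v$-path $P$ with $V(P)\cap X\subseteq\{u,v\}$. $X$ is a dual mutual-visibility set if every two vertices of $X$ are $X$-visible and every two vertices of $V(G)\setminus X$ are $X$-visible; $\mu_{\rm d}(G)$ is the maximum cardinality of a dual mutual-visibility set of $G$ (the empty set is allowed, so the value may be $0$). *)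

(* Defs.v *)
From mathcomp Require Import all_boot.
From mathcomp Require Import boolp.

Set Implicit Arguments.
Unset Strict Implicit.
Unset Printing Implicit Defensive.

Section Visibility.

(* A graph is given by its adjacency relation e on a finite vertex type. *)
Variables (T : finType) (e : rel T).

(* The vertex sequence u :: p is a shortest u,v-path. Repetitions need not be
   excluded: a walk of minimum length has none. *)
Definition shortest_path (u v : T) (p : seq T) : Prop :=
  [/\ path e u p, last u p = v
    & forall q : seq T, path e u q -> last u q = v -> size p <= size q].

Definition visible (X : {set T}) (u v : T) : Prop :=
  exists2 p : seq T, shortest_path u v p &
    [set w in u :: p] :&: X \subset [set u; v].

Definition dual_mutual_visibility_set (X : {set T}) : Prop :=
  {in X &, forall u v, visible X u v} /\
  {in ~: X &, forall u v, visible X u v}.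

(* The maximum over an empty family is 0, but for a connected graph the empty
   set is always a dual mutual-visibility set. *)
Definition dual_mutual_visibility_number : nat :=
  \max_(X : {set T} | `[< dual_mutual_visibility_set X >]) #|X|.

End Visibility.

(* ordS is the successor modulo n. This is the simple graph C_n when n >= 3;
   for n = 1 it is a loop. *)
Definition cycle_graph (n : nat) : rel 'I_n :=
  fun i j => (j == ordS i) || (i == ordS j).

Definition cartesian_product (T1 T2 : finType) (e1 : rel T1) (e2 : rel T2) :
    rel (T1 * T2) :=
  fun x y => (x.1 == y.1) && e2 x.2 y.2 || e1 x.1 y.1 && (x.2 == y.2).

(* Main.v *)
(* A graph metric [dist] that drops by one along some edge out of every point
   determines the shortest paths, so visibility can be read off from the sum of
   the two cycle distances.

   Suppose that X is a dual mutual-visibility set. Two vertices of the same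
   colour, at distance k in a row of length n > 2k, are joined by a unique
   geodesic, and its interior must avoid X. For n >= 5 and k = 2 this forces
   the runs of X in every row to have length exactly 2, and for n >= 7 the case
   k = 3 excludes these runs as well, so X is empty. For n, m >= 5 the columns
   also have runs of length 2; since no unit square is contained in X, the runs
   form a staircase, and two vertices of a staircase at opposite corners of a
   2 x 3 rectangle do not see each other. The seven remaining tori are settled
   by a backtracking search, carried out by computation. *)
Require Import Defs.
From mathcomp Require Import all_boot.
From mathcomp Require Import boolp zify.

Set Implicit Arguments.
Unset Strict Implicit.
Unset Printing Implicit Defensive.

(** * Visibility along a graph metric *)

Section Geodesics.
Variables (T : finType) (e : rel T) (dist : T -> T -> nat).
Hypothesis dist_eq0 : forall u v, (dist u v == 0) = (u == v).
Hypothesis dist_lip : forall u v w, e u w -> dist u v <= (dist w v).+1.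
Hypothesis dist_descent : forall u v,
  0 < dist u v -> exists2 w, e u w & dist u v = (dist w v).+1.

(** Each edge changes the distance by at most one. The bound covers every vertex of the walk so that
    it also shows that a geodesic never returns to its start. *)
Lemma dist_path u p : path e u p ->
  {in u :: p, forall x, dist x (last u p) <= size p}.
Proof.
elim: p u => [|w p IHp] u /= => [_|/andP[euw wp]] x.
  by rewrite inE => /eqP ->; rewrite leqn0 dist_eq0.
rewrite inE => /predU1P[->|xp]; last exact: leqW (IHp _ wp _ xp).
by rewrite (leq_trans (dist_lip _ euw)) // ltnS (IHp _ wp) ?mem_head.
Qed.

Lemma geodesic_exists u v :
  exists p, [/\ path e u p, last u p = v & size p = dist u v].
Proof.
elim: {u}(dist u v) {-2}u (erefl (dist u v)) => [|k IHk] u duv.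
  by exists [::]; split=> //; apply/eqP; rewrite -dist_eq0 duv.
have [|w euw] := @dist_descent u v; first by rewrite duv.
rewrite duv => -[/esym dwv]; have [p [wp pv sp]] := IHk _ dwv.
by exists (w :: p); split; rewrite /= ?euw // sp -dwv.
Qed.

Lemma shortest_pathP u v p : shortest_path e u v p <->
  [/\ path e u p, last u p = v & size p = dist u v].
Proof.
split=> [[up pv min_p]|[up pv sp]].
  have [q [uq qv sq]] := geodesic_exists u v; split=> //; apply/eqP.
  rewrite eqn_leq -{1}sq min_p //= -pv.
  by have := dist_path up; apply; rewrite mem_head.
split=> // q uq qv; rewrite sp -qv.
by have := dist_path uq; apply; rewrite mem_head.
Qed.

Lemma visible_near X u v : dist u v <= 1 -> visible e X u v.
Proof.
have [p [up pv sp]] := geodesic_exists u v; rewrite -sp => p_le1.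
exists p; first exact/shortest_pathP.
apply/subsetP=> x; rewrite !inE => /andP[/predU1P[->|xp] _].
  by rewrite eqxx.
case: p p_le1 pv xp {up sp} => [|y [|]] //= _ ->.
by rewrite !inE => ->; rewrite orbT.
Qed.

Lemma visible_step X u v : 1 < dist u v ->
  visible e X u v <->
  exists w, [/\ e u w, dist u v = (dist w v).+1, w \notin X & visible e X w v].
Proof.
move=> duv_gt1; split.
  case=> -[|w p] /shortest_pathP[].
    by move=> _ _ /= d0; rewrite -d0 in duv_gt1.
  move=> /= /andP[euw wp] pv sp /subsetP Xp.
  have dwv : dist u v = (dist w v).+1.
    apply/eqP; rewrite eqn_leq dist_lip // -sp ltnS -pv.
    by rewrite (dist_path wp) ?mem_head.
  (* By [dist_path], all vertices of [w :: p] are within [size p] of [v], and [u] is one step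
     further away. *)
  have u_p : u \notin w :: p.
    apply/negP=> /(dist_path wp); rewrite pv dwv => dp.
    by move: sp; rewrite dwv => -[sp]; rewrite sp ltnn in dp.
  exists w; split=> //.
    apply/negP=> Xw; have := Xp w; rewrite !inE eqxx orbT Xw => /(_ isT).
    case/pred2P=> wE; first by rewrite wE mem_head in u_p.
    by move: duv_gt1; rewrite dwv wE ltnS lt0n dist_eq0 eqxx.
  exists p.
    by apply/shortest_pathP; split=> //; move: sp; rewrite dwv => -[].
  apply/subsetP=> x; rewrite !in_set => /andP[xp Xx].
  have /Xp : x \in [set y in [:: u, w & p]] :&: X.
    by rewrite !in_set in_cons xp orbT.
  rewrite !inE => /predU1P[xu|->]; last by rewrite orbT.
  by rewrite -xu xp in u_p.
case=> w [euw duv Xw [p /shortest_pathP[wp pv sp] /subsetP Xp]].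
exists (w :: p).
  by apply/shortest_pathP; split; rewrite /= ?euw // duv sp.
apply/subsetP=> x; rewrite in_setI inE in_cons => /andP[/predU1P[->|xp] Xx].
  by rewrite !inE eqxx.
have /Xp : x \in [set y in w :: p] :&: X by rewrite !inE Xx andbT -in_cons.
rewrite !inE => /predU1P[xw|->]; last by rewrite orbT.
by rewrite -xw Xx in Xw.
Qed.

End Geodesics.

(** * Distances in cycles and tori *)

(** Subtraction is truncated, so [k] is the absolute difference of [i] and [j]. *)
Definition cdist n i j := let k := (i - j) + (j - i) in minn k (n - k).
Definition csucc n i := if i.+1 == n then 0 else i.+1.
Definition cpred n i := if i == 0 then n.-1 else i.-1.

Lemma val_ordS n (i : 'I_n) : val (ordS i) = csucc n i.
Proof.
rewrite /csucc /=; case: eqP => [->|ne]; first by rewrite modnn.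
by rewrite modn_small //; have := ltn_ord i; lia.
Qed.

Lemma cycle_graphE n (i j : 'I_n) :
  cycle_graph i j = (val j \in [:: csucc n i; cpred n i]).
Proof.
rewrite /cycle_graph -!(inj_eq val_inj) !val_ordS !inE /=.
have := ltn_ord i; have := ltn_ord j; rewrite /csucc /cpred.
by do 3!case: ifP; lia.
Qed.

Lemma cdist_eq0 n (i j : 'I_n) : (cdist n i j == 0) = (i == j).
Proof.
rewrite -val_eqE /cdist /=; have := ltn_ord i; have := ltn_ord j; lia.
Qed.

Lemma cdist_lip n (i j k : 'I_n) :
  cycle_graph i k -> cdist n i j <= (cdist n k j).+1.
Proof.
rewrite cycle_graphE !inE /cdist /csucc /cpred /=.
have := ltn_ord i; have := ltn_ord j; have := ltn_ord k.
by do 2!case: ifP; lia.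
Qed.

Lemma cdist_descent n (i j : 'I_n) : 0 < cdist n i j ->
  exists2 k : 'I_n, cycle_graph i k & cdist n i j = (cdist n k j).+1.
Proof.
have lti := ltn_ord i; have ltj := ltn_ord j => d_gt0.
have ltS : csucc n i < n by rewrite /csucc; case: ifP; lia.
have ltP : cpred n i < n by rewrite /cpred; case: ifP; lia.
have [dS|dS] := eqVneq (cdist n i j) (cdist n (csucc n i) j).+1.
  by exists (Ordinal ltS) => //; rewrite cycle_graphE !inE eqxx.
exists (Ordinal ltP); first by rewrite cycle_graphE !inE eqxx orbT.
move: d_gt0 dS lti ltj; rewrite /cdist /csucc /cpred /=.
by do 2!case: ifP; lia.
Qed.

(** * The torus in natural-number coordinates *)

Section Torus.
Variables n m : nat.

Definition tdist (u v : nat * nat) := cdist n u.1 v.1 + cdist m u.2 v.2.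

Definition nbrs (u : nat * nat) :=
  [:: (csucc n u.1, u.2); (cpred n u.1, u.2);
      (u.1, csucc m u.2); (u.1, cpred m u.2)].

Notation torus := (cartesian_product (@cycle_graph n) (@cycle_graph m)).

(** Plain numbers keep the proofs inside ordinals out of the computation. *)
Definition coords (x : 'I_n * 'I_m) : nat * nat := (val x.1, val x.2).

Lemma coords_inj : injective coords.
Proof. by case=> i j [k l] [/val_inj -> /val_inj ->]. Qed.

Lemma torusE x y : torus x y = (coords y \in nbrs (coords x)).
Proof.
case: x y => [i j] [k l]; rewrite /cartesian_product /= !cycle_graphE.
rewrite !inE !xpair_eqE -!val_eqE /= ![nat_of_ord k == i]eq_sym.
by rewrite [nat_of_ord l == j]eq_sym; do 6?case: (_ == _).
Qed.

Lemma nbrs_coords x a : a \in nbrs (coords x) -> exists y, a = coords y.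
Proof.
case: x => -[i lti] [j ltj] anbr.
have [lta1 lta2] : a.1 < n /\ a.2 < m.
  case: a anbr => a1 a2; rewrite !inE !xpair_eqE /= /csucc /cpred.
  by do 4!case: ifP; lia.
by exists (Ordinal lta1, Ordinal lta2); case: a {anbr} lta1 lta2.
Qed.

Lemma tdist_eq0 x y : (tdist (coords x) (coords y) == 0) = (x == y).
Proof. by case: x y => [i j] [k l]; rewrite addn_eq0 !cdist_eq0. Qed.

Lemma tdist_lip x y z : torus x z ->
  tdist (coords x) (coords y) <= (tdist (coords z) (coords y)).+1.
Proof.
rewrite /tdist /=; case/orP=> /andP[].
  by move=> /eqP -> exz; rewrite -addnS leq_add2l cdist_lip.
by move=> exz /eqP ->; rewrite -addSn leq_add2r cdist_lip.
Qed.

Lemma tdist_descent x y : 0 < tdist (coords x) (coords y) ->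
  exists2 z, torus x z
    & tdist (coords x) (coords y) = (tdist (coords z) (coords y)).+1.
Proof.
rewrite /tdist /= addn_gt0 => /orP[]/cdist_descent[k ek dk].
  by exists (k, x.2); rewrite /cartesian_product /= ?dk // ek eqxx orbT.
by exists (x.1, k); rewrite /cartesian_product /= ?dk ?addnS // ek eqxx.
Qed.

Definition tvisible_near X x y :=
  @visible_near _ torus _ tdist_eq0 tdist_lip tdist_descent X x y.
Definition tvisible_step X x y :=
  @visible_step _ torus _ tdist_eq0 tdist_lip tdist_descent X x y.

(* The interiors of the geodesics from [u] to [v], whose distance must be [k]. *)
Fixpoint geodesics k (u v : nat * nat) : seq (seq (nat * nat)) :=
  if k is (k'.+1 as k1).+1 then
    flatten [seq [seq w :: p | p <- geodesics k1 w v]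
            | w <- nbrs u & tdist w v == k1]
  else [:: [::]].

Definition unblocked (S : seq (nat * nat)) p := ~~ has (mem S) p.

Lemma visible_geodesics (X : {set 'I_n * 'I_m}) S x y :
    (forall z, (coords z \in S) = (z \in X)) ->
  let u := coords x in let v := coords y in
  visible torus X x y <-> has (unblocked S) (geodesics (tdist u v) u v).
Proof.
move=> SX /=; elim: {x}(tdist _ _) {-2}x (erefl (tdist (coords x) (coords y))).
  by move=> x d0; rewrite d0; split=> // _; apply: tvisible_near; rewrite d0.
case=> [|k] IHk x dxy.
  by rewrite dxy; split=> // _; apply: tvisible_near; rewrite dxy.
have d_gt1 : 1 < tdist (coords x) (coords y) by rewrite dxy.
rewrite dxy; split=> [/(tvisible_step _ d_gt1)[z [exz dz Xz vis]]|].
  have {}dz : tdist (coords z) (coords y) = k.+1.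
    by move: dz; rewrite dxy => -[].
  have /hasP[p gp Sp] := proj1 (IHk z dz) vis; rewrite dz in gp.
  apply/hasP; exists (coords z :: p).
    apply/flatten_mapP; exists (coords z); last by rewrite mem_map // => ? ? [].
    by rewrite mem_filter dz eqxx -torusE.
  by rewrite /unblocked /= SX negb_or Xz.
case/hasP=> _ /flatten_mapP[a + /mapP[p gp ->]].
rewrite mem_filter => /andP[/eqP + anbr].
have [z az] := nbrs_coords anbr; rewrite {a}az -torusE in anbr gp *.
rewrite /unblocked /= SX negb_or => dz /andP[Xz Sp].
apply/(tvisible_step _ d_gt1); exists z; split=> //; first by rewrite dz.
by apply/(IHk _ dz); rewrite dz; apply/hasP; exists p.
Qed.


(** * Exhaustive search *)

Definition verts := [seq (i, j) | j <- iota 0 m, i <- iota 0 n].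

Lemma mem_verts x : coords x \in verts.
Proof.
case: x => i j; apply/allpairsP; exists (val j, val i).
by rewrite !mem_iota /=.
Qed.

Lemma vertsP a : a \in verts -> exists x, a = coords x.
Proof.
case/allpairsP=> -[j i]; rewrite !mem_iota /= => -[ltj lti ->].
by exists (Ordinal lti, Ordinal ltj).
Qed.

Lemma verts_uniq : uniq verts.
Proof.
by apply: allpairs_uniq; rewrite ?iota_uniq // => -[? ?] [? ?] _ _ [-> ->].
Qed.

(* The table is bound outside the abstraction over [S] so that it is computed
   only once for all the sets [S] that are filtered. *)
Definition compatible s v : seq (nat * nat) -> bool :=
  let tbl := [seq (w, geodesics (tdist v w) v w) | w <- s] in
  fun S => let b := v \in S in
  all (fun t => if b == (t.1 \in S) then has (unblocked S) t.2 else true) tbl.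

Lemma compatibleE s v S : compatible s v S =
  all (fun w => ((v \in S) == (w \in S)) ==>
                has (unblocked S) (geodesics (tdist v w) v w)) s.
Proof. by rewrite /compatible all_map; apply: eq_all => w /=; case: eqP. Qed.

Lemma unblocked_sub S1 S2 p :
  {subset S1 <= S2} -> unblocked S2 p -> unblocked S1 p.
Proof.
by move=> sS; apply: contra => /hasP[w wp /sS wS]; apply/hasP; exists w.
Qed.

(** This makes pruning sound: restricting to fewer vertices keeps their colours and can only unblock
    geodesics. *)
Lemma compatible_filter (a : pred (nat * nat)) s1 s2 v :
    {subset s1 <= s2} -> v \in s2 ->
  compatible s2 v (filter a s2) -> compatible s1 v (filter a (v :: s1)).
Proof.
move=> s12 vs2; rewrite !compatibleE => /allP s2ok; apply/allP=> w ws1.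
move: (s2ok w (s12 w ws1)); rewrite !mem_filter mem_head vs2 in_cons ws1 s12 //.
rewrite orbT !andbT; case: eqP => // _ /hasP[p gp Sp].
apply/hasP; exists p => //.
apply: unblocked_sub Sp => b; rewrite !mem_filter in_cons.
by case/andP=> -> /predU1P[->|/s12].
Qed.

(* The subsets of [s] that survive when the vertices are decided one by one.
   Vertices that are not decided yet count as being outside of the set, which
   can only unblock geodesics. *)
Fixpoint search s :=
  if s is v :: s' then
    let L := search s' in
    filter (compatible s' v) (L ++ map (cons v) L)
  else [:: [::]].

Lemma search_subseq s S : S \in search s -> subseq S s.
Proof.
elim: s S => [|v s IHs] S; first by rewrite inE => /eqP ->.
rewrite mem_filter mem_cat => /andP[_ /orP[/IHs sSs|/mapP[S' /IHs sSs ->]]].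
  exact: subseq_trans sSs (subseq_cons _ _).
by rewrite /= eqxx.
Qed.

Lemma filter_search (a : pred (nat * nat)) s0 s : {subset s <= s0} ->
    {in s0, forall v, compatible s0 v (filter a s0)} ->
  filter a s \in search s.
Proof.
move=> + s0ok; elim: s => [|v s IHs] //= vs_s0.
have s_s0 : {subset s <= s0} by move=> w ws; rewrite vs_s0 // in_cons ws orbT.
have vs0 : v \in s0 by rewrite vs_s0 ?mem_head.
rewrite mem_filter (compatible_filter s_s0 vs0 (s0ok v vs0)) /= mem_cat.
case: (a v); last by rewrite IHs.
by rewrite map_f ?orbT ?IHs.
Qed.

(** A vertex decided later may block a geodesic accepted earlier, so the survivors are checked again
    against all vertices, with one geodesic table per vertex. *)
Definition dual_sets :=
  foldr (fun v => filter (compatible verts v)) (search verts) verts.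

Lemma mem_dual_sets S :
  (S \in dual_sets) =
  all (fun v => compatible verts v S) verts && (S \in search verts).
Proof.
rewrite /dual_sets; move: (search _) => L.
(* The induction runs over the tested vertices only; the tables still range over all of [verts]. *)
by elim: {2 4}verts => [|v s IHs] //=; rewrite mem_filter IHs andbA.
Qed.

Lemma dual_compatible (X : {set 'I_n * 'I_m}) S :
    (forall z, (coords z \in S) = (z \in X)) ->
  dual_mutual_visibility_set torus X <->
  all (fun v => compatible verts v S) verts.
Proof.
move=> SX; split=> [[visX visY]|/allP ok].
  apply/allP=> _ /vertsP[x ->]; rewrite compatibleE.
  apply/allP=> _ /vertsP[y ->]; rewrite !SX; apply/implyP=> /eqP xy.
  apply/(visible_geodesics _ _ SX).
  have [Xx|Yx] := boolP (x \in X); first by apply: visX; rewrite // -xy.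
  by apply: visY; rewrite in_setC // -xy.
have vis x y : (x \in X) = (y \in X) -> visible torus X x y.
  move=> xy; apply/(visible_geodesics _ _ SX).
  have := ok _ (mem_verts x); rewrite compatibleE => /allP/(_ _ (mem_verts y)).
  by rewrite !SX xy eqxx.
split=> x y; rewrite ?in_setC => xX yX; apply: vis; first by rewrite xX yX.
by rewrite (negPf xX) (negPf yX).
Qed.

Lemma dual_numberE :
  dual_mutual_visibility_number torus = foldr maxn 0 (map size dual_sets).
Proof.
rewrite foldrE big_map; apply/eqP; rewrite eqn_leq; apply/andP; split.
  apply/bigmax_leqP=> X /asboolP dualX.
  (* [X] must be listed in the order of [verts], since the search produces only subsequences of
     [verts]. *)
  pose a b := b \in [seq coords x | x in X].
  have SX z : (coords z \in filter a verts) = (z \in X).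
    by rewrite mem_filter mem_verts andbT /a mem_image //; apply: coords_inj.
  have okX := proj1 (dual_compatible SX) dualX.
  have <- : size (filter a verts) = #|X|.
    rewrite -(size_image coords); apply/perm_size/uniq_perm.
    - exact/filter_uniq/verts_uniq.
    - by rewrite map_inj_uniq ?enum_uniq //; apply: coords_inj.
    move=> b; rewrite mem_filter andb_idr // => /imageP[x _ ->].
    exact: mem_verts.
  apply: (@leq_bigmax_seq _ _ xpredT) => //.
  by rewrite mem_dual_sets okX; apply: filter_search (allP okX).
apply/bigmax_leqP_seq=> S; rewrite mem_dual_sets.
move=> /andP[okS /search_subseq sS] _.
pose X := [set x | coords x \in S].
have SX z : (coords z \in S) = (z \in X) by rewrite inE.
have -> : size S = #|X|.
  rewrite -(size_image coords); apply/perm_size/uniq_perm.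
  - exact: subseq_uniq sS verts_uniq.
  - by rewrite map_inj_uniq ?enum_uniq //; apply: coords_inj.
  move=> b; apply/idP/imageP=> [bS|[x Xx ->]]; last by rewrite SX.
  by have [x bx] := vertsP (mem_subseq sS bS); exists x; rewrite -?SX -?bx.
by apply: leq_bigmax_cond; apply/asboolP/(dual_compatible SX).
Qed.

End Torus.

(** * Local obstructions *)

Lemma cdistC n i j : cdist n i j = cdist n j i.
Proof. by rewrite /cdist addnC. Qed.

Lemma val_iter_ordS n k (i : 'I_n) : val (iter k (@ordS n) i) = (i + k) %% n.
Proof.
elim: k => [|k IHk]; first by rewrite addn0 modn_small.
by rewrite iterS /= -/(val (iter k _ i)) IHk -addn1 modnDml addn1 addnS.
Qed.

Lemma cdist_iterE n k (i : 'I_n) :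
  k <= n -> cdist n i (iter k (@ordS n) i) = minn k (n - k).
Proof.
move=> kn; have lti := ltn_ord i; rewrite /cdist val_iter_ordS.
have [lt|ge] := ltnP (i + k) n; first by rewrite modn_small //; lia.
by rewrite -(subnKC ge) modnDl modn_small; lia.
Qed.

Lemma cdist_iter n k (i : 'I_n) :
  k.*2 <= n -> cdist n i (iter k (@ordS n) i) = k.
Proof. by move=> kn; rewrite cdist_iterE; lia. Qed.

Lemma cdist0 n i : cdist n i i = 0.
Proof. by rewrite /cdist subnn min0n. Qed.

(* Every geodesic from [i] to [j] starts with the edge from [i] to [i']. *)
Definition only_hop n (i j i' : 'I_n) :=
  forall k, cycle_graph i k -> cdist n i j = (cdist n k j).+1 -> k = i'.

(** The strict bound makes the forward arc the only shortest one: the predecessor of [i] is at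
    distance [minn k.+1 (n - k.+1)], which is at least [k]. *)
Lemma only_hop_iter n k (i : 'I_n) :
  k.*2 < n -> only_hop i (iter k (@ordS n) i) (ordS i).
Proof.
move=> kn t /orP[/eqP //|/eqP ->].
by rewrite cdist_iterE -?iterSr ?cdist_iterE; lia.
Qed.

Lemma only_hop_adj n (i j : 'I_n) : cdist n i j = 1 -> only_hop i j j.
Proof.
by move=> dij k _; rewrite dij => -[/esym/eqP]; rewrite cdist_eq0 => /eqP.
Qed.

Lemma only_hop_refl n (i i' : 'I_n) : only_hop i i i'.
Proof. by move=> k _; rewrite cdist0. Qed.

Section Obstructions.
Variables (n m : nat) (X : {set 'I_n * 'I_m}).

Notation torus := (cartesian_product (@cycle_graph n) (@cycle_graph m)).

(** A geodesic of the product starts with a distance-decreasing move in one factor, and each factor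
    has only one candidate. *)
Lemma visible_hop i j k l i' j' :
    only_hop i k i' -> only_hop j l j' -> 1 < cdist n i k + cdist m j l ->
    visible torus X (i, j) (k, l) ->
  0 < cdist n i k /\ (i', j) \notin X /\ visible torus X (i', j) (k, l) \/
  0 < cdist m j l /\ (i, j') \notin X /\ visible torus X (i, j') (k, l).
Proof.
move=> hop_i hop_j d1.
move=> /(tvisible_step _ (x := (i, j)) (y := (k, l)) d1)[[z1 z2] []].
rewrite /tdist /= => /orP[] /andP[] /=;
  [move=> /eqP <- | move=> + /eqP <-] => ez dz Xz vz.
  have dj : cdist m j l = (cdist m z2 l).+1.
    by apply: (@addnI (cdist n i k)); rewrite addnS.
  by right; rewrite dj -(hop_j _ ez dj).
have di : cdist n i k = (cdist n z1 k).+1 by apply: (@addIn (cdist m j l)).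
by left; rewrite di -(hop_i _ ez di).
Qed.

Hypothesis dualX : dual_mutual_visibility_set torus X.

Lemma dual_visible x y : (x \in X) = (y \in X) -> visible torus X x y.
Proof.
case: dualX => visX visY xy; have [Xx|Yx] := boolP (x \in X).
  by apply: visX; rewrite // -xy.
by apply: visY; rewrite in_setC // -xy.
Qed.

Lemma row_gap k i j : 1 < k -> k.*2 < n ->
  ((i, j) \in X) = ((iter k (@ordS n) i, j) \in X) -> (ordS i, j) \notin X.
Proof.
move=> k1 kn /dual_visible vis.
have hj := @only_hop_refl m j j.
have [|[_ [//]]|] := visible_hop (only_hop_iter kn) hj _ vis.
  by rewrite cdist_iter ?cdist0 ?addn0 // ltnW.
by rewrite cdist0 => -[].
Qed.

Lemma col_gap k i j : 1 < k -> k.*2 < m ->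
  ((i, j) \in X) = ((i, iter k (@ordS m) j) \in X) -> (i, ordS j) \notin X.
Proof.
move=> k1 km /dual_visible vis.
have hi := @only_hop_refl n i i.
have [||[_ [//]]] := visible_hop hi (only_hop_iter km) _ vis.
  by rewrite cdist_iter ?cdist0 // ltnW.
by rewrite cdist0 => -[].
Qed.

Lemma square_gap i j : 2 < n -> 2 < m ->
  ((i, j) \in X) = ((ordS i, ordS j) \in X) ->
  ((ordS i, j) \notin X) || ((i, ordS j) \notin X).
Proof.
move=> n3 m3 /dual_visible vis.
have hi := @only_hop_iter n 1 i n3; have hj := @only_hop_iter m 1 j m3.
have [|[_ [->]]|[_ [->]]] := visible_hop hi hj _ vis; rewrite ?orbT //.
by rewrite !cdist_iter // ltnW.
Qed.

(** Every geodesic between these opposite corners meets one of the two vertices over [ordS i].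
    Taking [l] at distance 1 from [j] covers both orientations. *)
Lemma blocked_rectangle i (j l : 'I_m) : 4 < n -> 2 < m -> cdist m j l = 1 ->
    (i, j) \in X -> (ordS (ordS i), l) \in X ->
  (ordS i, j) \in X -> (ordS i, l) \notin X.
Proof.
move=> n5 m3 dj X1 X2 X3; apply/negP=> X4.
have /dual_visible vis : ((i, j) \in X) = ((ordS (ordS i), l) \in X).
  by rewrite X1 X2.
have hi := @only_hop_iter n 2 i n5; have di : cdist n i (ordS (ordS i)) = 2.
  by rewrite (@cdist_iter n 2) // ltnW.
have [|[_ [/negP//]]|[_ [_ {}vis]]] := visible_hop hi (only_hop_adj dj) _ vis.
  by rewrite di dj.
have [|[_ [/negP//]]|[]] := visible_hop hi (@only_hop_refl m l l) _ vis.
  by rewrite di cdist0.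
by rewrite cdist0.
Qed.

(** Let p0, ..., p4 be consecutive in the row, with p2 = [x] in [X]. Then p3 and p4 both differ in
    colour from p1. If they were in [X], p2 and p4 would not see each other; so they are outside and
    p1 is inside. Now p0 must differ from both p2 and p3, whose colours are opposite. *)
Lemma notin_dual_set7 x : 6 < n -> x \notin X.
Proof.
case: x => i j n7; rewrite -[i]ord_predK.
set a := ord_pred i; set b := ord_pred a.
have aE : a = ordS b by rewrite ord_predK.
have n5 : 4 < n by apply: ltn_trans n7.
have := @row_gap 2 b j isT n5; have := @row_gap 3 b j isT n7.
have := @row_gap 2 (ordS b) j isT n5; have := @row_gap 3 (ordS b) j isT n7.
have := @row_gap 2 (ordS (ordS b)) j isT n5; rewrite aE /=.
by do 5?case: (_ \in X) => //=; do ?[move=> /(_ erefl) //|move=> _].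
Qed.

(** If both were in [X], [col_gap] would put exactly one column neighbour of [(ordS i, j)] in [X].
    By [square_gap] the vertex before it in its row is outside, so by [row_gap] the vertex after it
    is inside, and [blocked_rectangle] applies. *)
Lemma no_row_pair i j : 4 < n -> 4 < m ->
  (i, j) \in X -> (ordS i, j) \notin X.
Proof.
move=> n5 m5; have n3 : 2 < n by apply: ltn_trans n5.
have m3 : 2 < m by apply: ltn_trans m5.
rewrite -[j]ord_predK; set c := ord_pred j => X1; apply/negP=> X2.
have d1 : cdist m c (ordS c) = 1 by rewrite (@cdist_iter m 1) // ltnW.
have d2 : cdist m (ordS c) (ordS (ordS c)) = 1.
  by rewrite (@cdist_iter m 1) // ltnW.
have up := @blocked_rectangle i _ _ n5 m3 d2 X1.
have down := @blocked_rectangle i _ _ n5 m3 (etrans (cdistC _ _ _) d1) X1.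
have := @row_gap 2 i c isT n5; have := @row_gap 2 i (ordS (ordS c)) isT n5.
have := @col_gap 2 i c isT m5; have := @col_gap 2 (ordS i) c isT m5.
have := @square_gap i c n3 m3; have := @square_gap i (ordS c) n3 m3.
move: up down; rewrite /= X1 X2.
by do 6?case: (_ \in X) => //=; do ?[move=> /(_ erefl) //|move=> _].
Qed.

(** Both row neighbours of a vertex of [X] would be outside by [no_row_pair], hence of equal colour,
    against [row_gap]. *)
Lemma notin_dual_set5 x : 4 < n -> 4 < m -> x \notin X.
Proof.
case: x => i j n5 m5; apply/negP; rewrite -[i]ord_predK.
set a := ord_pred i => X1.
have := @row_gap 2 a j isT n5; rewrite /= X1.
have := @no_row_pair a j n5 m5; have := @no_row_pair (ordS a) j n5 m5.
by rewrite X1; do 2!case: (_ \in X) => //=; do ?[move=> /(_ erefl) //|move=> _].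
Qed.
End Obstructions.

Theorem theorem4p6 (n m : nat) (hm : 3 <= m) (hmn : m <= n) :
  dual_mutual_visibility_number
    (cartesian_product (@cycle_graph n) (@cycle_graph m)) =
  if (n, m) \in [:: (3, 3); (4, 3)] then 5
  else if (n, m) == (4, 4) then 8
  else if (n, m) == (5, 3) then 2
  else if (n, m) \in [:: (5, 4); (6, 3); (6, 4)] then 4
  else 0.
Proof.
have [large|small] := boolP ((6 < n) || (4 < m)).
  transitivity 0; last by rewrite !inE !xpair_eqE; do !case: ifP; lia.
  apply/eqP; rewrite -leqn0; apply/bigmax_leqP=> X /asboolP dualX.
  rewrite leqn0 cards_eq0; apply/set0Pn => -[x]; apply/negP.
  case/orP: large => [n7|m5]; first exact: notin_dual_set7.
  by apply: notin_dual_set5 => //; apply: leq_trans hmn.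
move: small hm hmn.
(* What remains is [m = 3] with [n] from 3 to 6, then [m = 4] with [n] from 4 to 6; the virtual
   machine evaluates each search at [Qed]. *)
case: m => [|[|[|[|[|m']]]]] //; case: n => [|[|[|[|[|[|[|n']]]]]]] // _ _ _.
- rewrite dual_numberE; vm_cast_no_check (erefl 5).
- rewrite dual_numberE; vm_cast_no_check (erefl 5).
- rewrite dual_numberE; vm_cast_no_check (erefl 2).
- rewrite dual_numberE; vm_cast_no_check (erefl 4).
- rewrite dual_numberE; vm_cast_no_check (erefl 8).
- rewrite dual_numberE; vm_cast_no_check (erefl 4).
- rewrite dual_numberE; vm_cast_no_check (erefl 4).
Qed.
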